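(* Let $N\ge1$, $p=2N+1$, and let $(b,v)\in\mathbb{T}\times\mathbb{R}^p$, $v=(v_k)_1^p$, $\mathbb{T}=\mathbb{R}/(2\pi\mathbb{Z})$. Let $H_b=\Delta_b+V$ be the operator defined in the context. Then $\sigma_{pp}(H_b)\neq\emptyset$ if and only if $v_{2n+1}=v_1$ for every $n\in\{1,\dots,N\}$. Moreover, if $\sigma_{pp}(H_b)\ne\emptyset$, then $\sigma_{pp}(H_b)=\sigma_0(H_b)=\{v_1\}$, and for all $n\in\{1,\dots,N\}$ one has $|\sigma_n(H_b)|>0$, $\sigma_n(H_b)\subset(v_1,+\infty)$ and $\sigma_{-n}(H_b)\subset(-\infty,v_1)$.
   Context: Let $\ell^2(\Gamma)$ be the Hilbert space of functions $f=(f_{n,k})_{(n,k)\in\mathbb{Z}\times\{1,\dots,p\}}$ with norm $\|f\|^2=\sum|f_{n,k}|^2$, $p=2N+1$. The operator $\Delta_b$ acts on $\ell^2(\Gamma)$ by $$(\Delta_bf)_{n,2k+1}=e^{-ib(2n+k)}f_{n,2k}+e^{ib(n+2k)}f_{n-1,2k+2}+e^{ib(n-k)}f_{n,2k+2},\quad k\in\{0,1,\dots,N\},$$ $$(\Delta_bf)_{n,2k}=e^{-ib(n-k+1)}f_{n,2k-1}+e^{-ib(n+2k-1)}f_{n+1,2k-1}+e^{ib(2n+k)}f_{n,2k+1},\quad k\in\{1,\dots,N\},$$ for $n\in\mathbb{Z}$, with the Dirichlet convention $f_{n,0}=f_{n,p+1}=0$. The potential acts by $(Vf)_{n,k}=v_kf_{n,k}$,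 and $H_b=\Delta_b+V$. For $t\in[0,2\pi]$ let $J_t=J_t(b,v)$ be the symmetric $p\times p$ Jacobi matrix with diagonal $v_1,\dots,v_p$ and off-diagonal entries $(J_t)_{n,n+1}=(J_t)_{n+1,n}=a_n$, $1\le n\le p-1$, where $a_n=1$ for $n$ even and $a_n=2|\cos(\frac t2-\frac{3n-2}{2}b)|$ for $n$ odd. Its eigenvalues are $\lambda_{-N}(t)\le\dots\le\lambda_N(t)$; $\sigma_k(H_b)=\lambda_k([0,2\pi])$ for $k\in\{-N,\dots,N\}$ are the spectral bands of $H_b$ ($H_b$ is unitarily equivalent to $\int^{\oplus}_{[0,2\pi)}J_t\frac{dt}{2\pi}$). $\sigma_{pp}(H_b)$ is the set of eigenvalues of $H_b$, and $|\cdot|$ denotes the length of an interval. *)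

(* Defs.v *)
From HB Require Import structures.
From mathcomp Require Import all_boot all_order all_algebra.
From mathcomp Require Import complex polyrcf.
From mathcomp Require Import all_classical all_reals all_analysis.

Set Implicit Arguments.
Unset Strict Implicit.
Unset Printing Implicit Defensive.

Import Order.TTheory GRing.Theory Num.Theory.

Local Open Scope classical_set_scope.
Local Open Scope ring_scope.
Local Open Scope complex_scope.

(* p = 2N+1 *)
Definition width (N : nat) : nat := N.*2.+1.

(* Site (n, k) with 1 <= k <= p is represented by (n, k - 1). *)
Definition Gamma (N : nat) : Type := (int * 'I_(width N))%type.

(* The entry of index k, 1 <= k <= p; meaningless for other k. *)
Definition entry (T : Type) (N : nat) (v : 'I_(width N) -> T) (k : nat) : T :=
  v (inord k.-1).

Section Operator.
Variables (R : realType) (N : nat).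
Implicit Types (b t : R) (v : 'I_(width N) -> R) (f : Gamma N -> R[i]).

Definition expi (x : R) : R[i] := cos x +i* sin x.

Definition square_summable f : Prop :=
  (\esum_(x in [set: Gamma N]) ((ComplexField.Normc.normc (f x)) ^+ 2)%:E
    < +oo)%E.

(* f_{n,k}, with the Dirichlet convention f_{n,0} = f_{n,p+1} = 0. *)
Definition at_site f (n : int) (k : nat) : R[i] :=
  if (1 <= k <= width N)%N then entry (fun j => f (n, j)) k else 0.

(* Row m = 2k+1 or m = 2k; in both cases k = m./2. *)
Definition Delta b f : Gamma N -> R[i] := fun x =>
  let n := x.1 in
  let m := x.2.+1 in
  let k := m./2 in
  let K := k%:Z in
  if odd m then
    expi (- (b * (2 * n + K)%:~R)) * at_site f n (2 * k)
    + expi (b * (n + 2 * K)%:~R) * at_site f (n - 1) (2 * k + 2)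
    + expi (b * (n - K)%:~R) * at_site f n (2 * k + 2)
  else
    expi (- (b * (n - K + 1)%:~R)) * at_site f n (2 * k - 1)
    + expi (- (b * (n + 2 * K - 1)%:~R)) * at_site f (n + 1) (2 * k - 1)
    + expi (b * (2 * n + K)%:~R) * at_site f n (2 * k + 1).

Definition potential v f : Gamma N -> R[i] := fun x => (v x.2)%:C * f x.

Definition H b v f : Gamma N -> R[i] := fun x => Delta b f x + potential v f x.

Definition sigma_pp b v : set R[i] :=
  [set lam | exists f, [/\ square_summable f, exists x, f x != 0 &
                           forall x, H b v f x = lam * f x]].

Definition offdiag b t (n : nat) : R :=
  if odd n then 2 * `| cos (t / 2 - ((3 * n)%:R - 2) / 2 * b) | else 1.

(* Rows and columns are numbered from 0, offdiag from 1. *)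
Definition Jacobi b v t : 'M[R]_(width N) :=
  \matrix_(i, j)
    if i == j then v i
    else if j == i.+1 :> nat then offdiag b t i.+1
    else if i == j.+1 :> nat then offdiag b t j.+1
    else 0.

End Operator.

(* The real eigenvalues in nondecreasing order, with algebraic multiplicity:
   [rootsR] is the strictly increasing list of the distinct real roots. *)
Definition eigenvalues (R : rcfType) (n : nat) (A : 'M[R]_n) : seq R :=
  flatten [seq nseq (mup x (char_poly A)) x | x <- rootsR (char_poly A)].

(* lambda_k(t), for -N <= k <= N. *)
Definition lambda (R : realType) (N : nat) (b : R) (v : 'I_(width N) -> R)
    (k : int) (t : R) : R :=
  nth 0 (eigenvalues (Jacobi b v t)) (absz (N%:Z + k)).

Definition sigma (R : realType) (N : nat) (b : R) (v : 'I_(width N) -> R)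
    (k : int) : set R :=
  lambda b v k @` `[0, 2 * pi].

(* Main.v *)
Require Import Defs.
From HB Require Import structures.
From mathcomp Require Import all_boot all_order all_algebra.
From mathcomp Require Import complex polyrcf.
From mathcomp Require Import all_classical all_reals all_analysis.
From mathcomp Require Import measurable_realfun finmap ring lra zify.

Set Implicit Arguments.
Unset Strict Implicit.
Unset Printing Implicit Defensive.

Import Order.TTheory GRing.Theory Num.Theory.
Import numFieldNormedType.Exports.

Local Open Scope classical_set_scope.
Local Open Scope ring_scope.
Local Open Scope complex_scope.

(** After the gauge transformation [gauged] the eigenvalue equation of [H b v]
    becomes a three-term recurrence in the transversal index whose coefficients
    are polynomials in the longitudinal shift.  Sequences that vanish at infinity
    form a torsion-free module over these polynomials, so an eigenvector forces
    the last continuant of the recurrence to be the zero polynomial; comparing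
    degrees, this happens only if all odd entries of the potential equal the
    eigenvalue.  Conversely, a flat potential admits a finitely supported
    eigenvector carried by the odd sites.

    In that case the odd sites span an isotropic subspace of dimension [N + 1]
    for [Jacobi b v t - v_1], which by the min-max principle pins the middle
    eigenvalue to [v_1]; it is simple because its eigenvectors are determined by
    their first coordinate.  Weyl's inequality makes the eigenvalues continuous
    in [t], and a constant one would again annihilate the last continuant, hence
    equal [v_1]; so the other bands contain a nondegenerate interval. *)

(** * Three-term recurrences *)

Section ThreeTerm.
Variable K : comNzRingType.
Implicit Types a w up lo : nat -> K.

(** Two consecutive values are carried to make the two-step recurrence structural. Up to the sign
    [(-1) ^+ m], the continuant is the determinant of the leading block of order [m] of a
    tridiagonal matrix with diagonal [a] and products of opposite off-diagonal entries [w]. *)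
Fixpoint continuants a w (m : nat) : K * K :=
  if m is m'.+1 then
    let: (x, y) := continuants a w m' in (y, - (a m'.+1 * y + w m' * x))
  else (1, - a 0%N).

Definition continuant a w m := (continuants a w m).1.

Lemma continuant0 a w : continuant a w 0 = 1. Proof. by []. Qed.

Lemma continuant1 a w : continuant a w 1 = - a 0%N. Proof. by []. Qed.

Lemma continuantSS a w m :
  continuant a w m.+2 =
  - (a m.+1 * continuant a w m.+1 + w m * continuant a w m).
Proof. by rewrite /continuant /=; case: (continuants a w m). Qed.

(** The recurrence is solved from its first term without division: the product of the [up i], which
    need not be invertible, clears the denominators. When [f p = 0], the case [m = p] says that the
    last continuant annihilates [f 0]. *)
Lemma continuant_solve (V : lmodType K) (p : nat) a up lo (f : nat -> V) :
  (0 < p)%N ->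
  a 0%N *: f 0%N + up 0%N *: f 1%N = 0 ->
  (forall m, (m.+1 < p)%N ->
     lo m *: f m + a m.+1 *: f m.+1 + up m.+1 *: f m.+2 = 0) ->
  forall m, (m <= p)%N ->
    (\prod_(i < m) up i) *: f m =
    continuant a (fun i => lo i * up i) m *: f 0%N.
Proof.
move=> p0 h0 hS.
suff H m : (m < p)%N ->
    (\prod_(i < m) up i) *: f m
      = continuant a (fun i => lo i * up i) m *: f 0%N /\
    (\prod_(i < m.+1) up i) *: f m.+1
      = continuant a (fun i => lo i * up i) m.+1 *: f 0%N.
  by case=> [|m] lemp; [have [] := H _ p0 | have [] := H _ lemp].
elim: m => [_|m IH ltmp].
  rewrite big_ord0 big_ord1 continuant0 continuant1; split=> //.
  by rewrite scaleNr; apply/eqP; rewrite -addr_eq0 addrC h0.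
have [E1 E2] := IH (ltnW ltmp); split=> //.
rewrite big_ord_recr /= -scalerA.
have /eqP := hS m ltmp; rewrite addrC addr_eq0 => /eqP ->.
rewrite continuantSS scaleNr scalerN scalerDr !scalerA.
rewrite [in X in _ + X]mulrC -[X in _ + X]scalerA E2.
rewrite big_ord_recr /= [_ * up m]mulrC [up m * _ * lo m]mulrAC -scalerA E1.
by rewrite scalerDl !scalerA addrC [up m * lo m]mulrC.
Qed.

End ThreeTerm.

Lemma continuant_horner (F : comNzRingType) (a w : nat -> {poly F}) (x : F) m :
  (continuant a w m).[x] = continuant (fun i => (a i).[x]) (fun i => (w i).[x]) m.
Proof.
suff : (continuant a w m).[x]
   = continuant (fun i => (a i).[x]) (fun i => (w i).[x]) m /\
  (continuant a w m.+1).[x]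
   = continuant (fun i => (a i).[x]) (fun i => (w i).[x]) m.+1 by case.
elim: m => [|m [E1 E2]]; first by rewrite !continuant0 !continuant1 !hornerE.
by split=> //; rewrite !continuantSS !hornerE E1 E2.
Qed.

(** * Degrees of continuants with polynomial coefficients *)

Section Degree.
Variables (F : fieldType) (c : nat -> F) (W : nat -> {poly F}).
Hypothesis sizeW : forall k, size (W k) = 3%N.

(** These are the coefficients once the even rows are multiplied by the shift ['X]. In the
    applications [c] is the potential minus the eigenvalue, and [band_prod] holds the products of
    opposite couplings. *)
Definition band_diag (m : nat) : {poly F} := if odd m then (c m)%:P else c m *: 'X.
Definition band_prod (m : nat) : {poly F} := if odd m then 'X else W m./2.

Lemma band_diag_even k : band_diag k.*2 = c k.*2 *: 'X.
Proof. by rewrite /band_diag odd_double. Qed.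

Lemma band_diag_odd k : band_diag k.*2.+1 = (c k.*2.+1)%:P.
Proof. by rewrite /band_diag /= odd_double. Qed.

Lemma band_prod_even k : band_prod k.*2 = W k.
Proof. by rewrite /band_prod odd_double doubleK. Qed.

Lemma band_prod_odd k : band_prod k.*2.+1 = 'X.
Proof. by rewrite /band_prod /= odd_double. Qed.

Let Q := continuant band_diag band_prod.

(** In an even step the term [W k * Q k.*2] gains two degrees and dominates, the other term being a
    constant times [Q k.*2.+1]. In an odd step the leading coefficient contains a factor [c], so
    only a bound survives. *)
Lemma size_continuant k :
  size (Q k.*2) = k.*2.+1 /\ (size (Q k.*2.+1) <= k.*2.+2)%N.
Proof.
have W0 j : W j != 0 by rewrite -size_poly_gt0 sizeW.
elim: k => [|k [E1 E2]].
  rewrite /Q continuant0 continuant1 size_poly1 size_polyN; split=> //.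
  rewrite (_ : band_diag 0 = c 0%N *: 'X) //.
  by rewrite (leq_trans (size_scale_leq _ _))// size_polyX.
have Q0 : Q k.*2 != 0 by rewrite -size_poly_gt0 E1.
have S2 : size (Q k.*2.+2) = k.*2.+3.
  rewrite {1}/Q continuantSS size_polyN band_diag_odd band_prod_even addrC.
  have sWQ : size (W k * Q k.*2) = k.*2.+3.
    by rewrite size_mul// sizeW E1.
  rewrite size_polyDl sWQ// ltnS (leq_trans _ E2)//.
  by rewrite mul_polyC size_scale_leq.
rewrite doubleS S2; split=> //.
rewrite {1}/Q continuantSS size_polyN -doubleS band_diag_even doubleS.
rewrite band_prod_odd (leq_trans (size_polyD _ _))// geq_max; apply/andP; split.
  rewrite -scalerAl (leq_trans (size_scale_leq _ _))//.
  by rewrite -/Q mulrC (leq_trans (size_polyMleq _ _))// size_polyX S2 addn2.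
by rewrite mulrC (leq_trans (size_polyMleq _ _))// size_polyX addn2 /= ltnS ltnW.
Qed.

(** Descent on [n]: in the last step of the recurrence, a nonzero [c n.+1.*2] would give the first
    term a degree that the second cannot reach. Once it is zero, the factor ['X] cancels and the
    previous odd continuant vanishes too. *)
Lemma continuant_eq0 n : Q n.*2.+1 = 0 -> forall k, (k <= n)%N -> c k.*2 = 0.
Proof.
elim: n => [|n IH] Qn0 k.
  rewrite leqn0 => /eqP ->.
  move/eqP: Qn0; rewrite /Q continuant1 oppr_eq0 (band_diag_even 0).
  by rewrite scaler_eq0 polyX_eq0 orbF => /eqP.
have [S1 _] := size_continuant n.+1; have [_ S2] := size_continuant n.
rewrite doubleS in S1 Qn0.
have := Qn0; rewrite /Q continuantSS -doubleS band_diag_even doubleS.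
rewrite band_prod_odd -!/Q.
move/eqP; rewrite oppr_eq0 -scalerAl addr_eq0 => /eqP E.
have cn0 : c n.+1.*2 = 0.
  apply/eqP; apply/negPn/negP => cn0.
  have : size (c n.+1.*2 *: ('X * Q n.*2.+2)) = n.*2.+4.
    rewrite size_scale// size_mul ?polyX_eq0 ?size_polyX ?S1 ?addn0//.
    by rewrite -size_poly_gt0 S1.
  move=> S3; have : (n.*2.+4 <= n.*2.+3)%N; last by rewrite ltnn.
  rewrite -S3 E size_polyN mulrC (leq_trans (size_polyMleq _ _))//.
  by rewrite size_polyX addn2 /= ltnS.
rewrite leq_eqVlt => /predU1P[->//|]; rewrite ltnS; apply: IH.
move/eqP: E; rewrite cn0 scale0r eq_sym oppr_eq0 mulf_eq0 polyX_eq0 /=.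
by move=> /eqP.
Qed.

End Degree.

(** * Sequences as a module over polynomials in the shift *)

(** A name of its own lets these sequences carry a module structure over [{poly F}], in which ['X]
    acts as the shift. *)
Definition shift_seq (F : comNzRingType) : Type := int -> F.

Section ShiftModule.
Variable F : comNzRingType.

HB.instance Definition _ := GRing.Zmodule.copy (shift_seq F) (int -> F).

Implicit Types (p q : {poly F}) (g h : shift_seq F).

Lemma shift_seqD g h n : (g + h) n = g n + h n. Proof. by []. Qed.

Definition shift g : shift_seq F := fun n => g (n + 1).

Definition poly_act p g : shift_seq F :=
  fun n => \sum_(i < size p) p`_i * g (n + i%:Z).

Lemma poly_act_widen p g n m : (size p <= m)%N ->
  poly_act p g n = \sum_(i < m) p`_i * g (n + i%:Z).
Proof.
move=> le; rewrite /poly_act (big_ord_widen m (fun i => p`_i * g (n + i%:Z)))//.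
rewrite big_mkcond; apply: eq_bigr => i _; case: ltnP => // H.
by rewrite nth_default // mul0r.
Qed.

Lemma poly_actDl g p q : poly_act (p + q) g = poly_act p g + poly_act q g.
Proof.
apply/funext => n; rewrite shift_seqD.
rewrite (@poly_act_widen _ _ _ (maxn (size p) (size q)) (size_polyD _ _)).
rewrite (@poly_act_widen p _ _ _ (leq_maxl _ (size q))).
rewrite (@poly_act_widen q _ _ _ (leq_maxr (size p) _)) -big_split /=.
by apply: eq_bigr => i _; rewrite coefD mulrDl.
Qed.

Lemma poly_actDr p g h : poly_act p (g + h) = poly_act p g + poly_act p h.
Proof.
apply/funext => n; rewrite shift_seqD /poly_act -big_split /=.
by apply: eq_bigr => i _; rewrite shift_seqD mulrDr.
Qed.

Lemma poly_actZ c p g : poly_act (c *: p) g = fun n => c * poly_act p g n.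
Proof.
apply/funext => n; rewrite (poly_act_widen _ _ (size_scale_leq c p)) mulr_sumr.
by apply: eq_bigr => i _; rewrite coefZ mulrA.
Qed.

Lemma poly_actC c g : poly_act c%:P g = fun n => c * g n.
Proof.
apply/funext => n; rewrite (poly_act_widen _ _ (size_polyC_leq1 c)).
by rewrite big_ord1 coefC eqxx addr0.
Qed.

Lemma poly_actMX p g : poly_act (p * 'X) g = poly_act p (shift g).
Proof.
apply/funext => n; rewrite (@poly_act_widen _ _ _ (size p).+1); last first.
  by rewrite (leq_trans (size_polyMleq _ _))// size_polyX addn2.
rewrite big_ord_recl coefMX eqxx mul0r add0r; apply: eq_bigr => i _.
by rewrite coefMX /= /bump /= add1n /shift; congr (_ * g _); lia.
Qed.

Lemma poly_act_shift p g : poly_act p (shift g) = shift (poly_act p g).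
Proof.
apply/funext => n; apply: eq_bigr => i _; congr (_ * _).
by rewrite /shift; congr g; lia.
Qed.

Lemma poly_actM p q g : poly_act p (poly_act q g) = poly_act (p * q) g.
Proof.
elim/poly_ind: p g => [|p c IH] g.
  by rewrite mul0r; apply/funext => n; rewrite /poly_act size_poly0 !big_ord0.
rewrite poly_actDl poly_actMX mulrDl poly_actDl mul_polyC poly_actZ poly_actC.
by rewrite mulrAC poly_actMX -IH !poly_act_shift.

Qed.

Lemma poly_act1 g : poly_act 1 g = g.
Proof. by rewrite poly_actC; apply/funext => n; rewrite mul1r. Qed.

HB.instance Definition _ := GRing.Zmodule_isLmodule.Build {poly F} (shift_seq F)
  poly_actM poly_act1 poly_actDr poly_actDl.

Lemma scale_shift_seqE p g : p *: g = poly_act p g. Proof. by []. Qed.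

End ShiftModule.

(** * Sequences vanishing at infinity have no polynomial torsion *)

Section Decay.
Variable C : numClosedFieldType.
Implicit Types (g h : shift_seq C) (p : {poly C}).

(** Convergence to zero at both ends of [int], the only consequence of square summability used for
    eigenvectors. *)
Definition decays g : Prop :=
  forall e : C, 0 < e -> finite_set [set n : int | e <= `|g n|].

Lemma decaysD g h : decays g -> decays h -> decays (g + h).
Proof.
move=> dg dh e e0; have e20 : 0 < e / 2 by rewrite divr_gt0.
apply: (@sub_finite_set _ _
  ([set n : int | e / 2 <= `|g n|] `|` [set n : int | e / 2 <= `|h n|])).
  move=> n /=; rewrite shift_seqD => le.
  have [?|] := real_leP (gtr0_real e20) (normr_real (g n)); first by left.
  have [?|] := real_leP (gtr0_real e20) (normr_real (h n)); first by right.
  move=> hn gn; have : e < e; last by rewrite ltxx.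
  by rewrite (le_lt_trans le)// (le_lt_trans (ler_normD _ _))// [ltRHS]splitr ltrD.
by rewrite finite_setU; split; [exact: dg | exact: dh].
Qed.

Lemma decaysZ (c : C) g : decays g -> decays (fun n => c * g n).
Proof.
move=> dg e e0; have [->|c0] := eqVneq c 0.
  rewrite (_ : mkset _ = set0); first exact: finite_set0.
  by apply/seteqP; split=> // n /=; rewrite mul0r normr0 lt_geF.
have c1 : 0 < `|c| by rewrite normr_gt0.
apply: sub_finite_set (dg (e / `|c|) _); last by rewrite divr_gt0.
by move=> n /=; rewrite normrM mulrC -ler_pdivrMr.
Qed.

Lemma decays_shift g : decays g -> decays (shift g).
Proof.
move=> dg e e0; apply: sub_finite_set (finite_image (fun n => n - 1) (dg e e0)).
by move=> n /= le; exists (n + 1); [exact: le | rewrite addrK].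
Qed.

Lemma decays_scale p g : decays g -> decays (p *: g).
Proof.
rewrite scale_shift_seqE; elim/poly_ind: p g => [|p c IH] g dg.
  move=> e e0; rewrite (_ : mkset _ = set0); first exact: finite_set0.
  apply/seteqP; split=> // n /=.
  by rewrite /poly_act size_poly0 big_ord0 normr0 lt_geF.
rewrite poly_actDl poly_actMX poly_actC.
by apply: decaysD; [apply: IH; exact: decays_shift | exact: decaysZ].
Qed.

(** A nonzero geometric sequence does not decrease in modulus in one of the two directions: forwards
    if [1 <= |z|], backwards otherwise. A level set would then be infinite. *)
Lemma decays_geometric (z : C) g :
  decays g -> (forall n, g (n + 1) = z * g n) -> g = 0.
Proof.
move=> dg gS; apply/funext => n; apply/eqP/negPn/negP => gn0.
have e0 : 0 < `|g n| by rewrite normr_gt0.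
suff [s s0 sE] : exists2 s : int, s != 0 &
    forall k : nat, `|g n| <= `|g (n + s * k%:Z)|.
  apply: infinite_nat.
  apply: (@sub_finite_set _ _
    ((fun k : nat => n + s * k%:Z) @^-1` [set m | `|g n| <= `|g m|])).
    by move=> k _ /=.
  apply: finite_preimage; last exact: dg.
  by move=> k l _ _ /addrI /(mulfI s0) [].
have [z1|z1] := real_leP (real1 C) (normr_real z).
  exists 1 => //; elim=> [|k IH]; first by rewrite mulr0 addr0.
  rewrite (le_trans IH)// !mul1r (_ : n + k.+1%:Z = n + k%:Z + 1); last by lia.
  rewrite gS normrM.
  by rewrite ler_peMl.
exists (-1) => //; elim=> [|k IH]; first by rewrite mulr0 addr0.
rewrite (le_trans IH)// !mulN1r (_ : n - k%:Z = (n - k.+1%:Z) + 1); last by lia.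
by rewrite gS normrM ler_piMl// ltW.
Qed.

(** Over an algebraically closed field [p] splits, and its linear factors are removed one at a time:
    a sequence killed by ['X - z%:P] is geometric of ratio [z]. *)
Theorem decays_torsion_free p g : decays g -> p != 0 -> p *: g = 0 -> g = 0.
Proof.
move=> dg p0; have [r rE] := closed_field_poly_normal p.
have lp0 : lead_coef p != 0 by rewrite lead_coef_eq0.
move=> pg0; have {pg0} : (\prod_(z <- r) ('X - z%:P)) *: g = 0.
  have E : (lead_coef p)%:P *: ((\prod_(z <- r) ('X - z%:P)) *: g) = 0.
    by rewrite scalerA mul_polyC -rE.
  rewrite -[LHS]scale1r.
  rewrite -[1 as X in X *: _](_ : ((lead_coef p)^-1)%:P * (lead_coef p)%:P = _).
    by rewrite -scalerA E scaler0.
  by rewrite -polyCM mulVf.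
elim: r {rE} => [|z r IH]; first by rewrite big_nil scale1r.
rewrite big_cons -scalerA => E; apply: IH.
apply: (@decays_geometric z); first exact: decays_scale.
move=> n; apply/eqP; rewrite -subr_eq0; apply/eqP.
set h := _ *: g in E *.
have := congr1 (fun f : shift_seq C => f n) E.
rewrite /= scale_shift_seqE -polyCN poly_actDl poly_actC -['X]mul1r poly_actMX.
by rewrite poly_act1 shift_seqD mulNr.
Qed.
End Decay.

(** * Eigenvalues of real symmetric matrices *)

Section Eigenvalues.
Local Open Scope sesquilinear_scope.
Variable R : rcfType.

Lemma sorted_flatten_nseq (m : R -> nat) (s : seq R) :
  sorted <%R s -> sorted <=%R (flatten [seq nseq (m x) x | x <- s]).
Proof.
elim: s => [//|x s IH] xs.
have {IH} := IH (path_sorted xs).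
have : all (>= x) (flatten [seq nseq (m x) x | x <- s]).
  apply/allP => y /flattenP[_ /mapP[z zs ->]] /nseqP[-> _].
  have := xs; rewrite /= lt_path_sortedE => /andP[/allP /(_ z zs) /ltW //].
rewrite /=; set t := flatten _ => xt st.
elim: (m x) => [//|k]; rewrite /= le_path_sortedE => ->.
by rewrite andbT all_cat xt andbT; apply/allP => y /nseqP[->].
Qed.

(** Both lists are sorted and contain each root with its multiplicity, so they coincide. *)
Lemma eigenvalues_sort n (A : 'M[R]_n) (s : seq R) :
  char_poly A = \prod_(x <- s) ('X - x%:P) -> eigenvalues A = sort <=%R s.
Proof.
move=> cE; have c0 : char_poly A != 0 by rewrite monic_neq0// char_poly_monic.
have sr : sorted <%R (rootsR (char_poly A)) by exact: sorted_roots.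
have pu : perm_eq (rootsR (char_poly A)) (undup s).
  apply: uniq_perm; rewrite ?undup_uniq ?(lt_sorted_uniq sr)// => x.
  have := roots_on_rootsR c0 x; rewrite in_itv /= => <-.
  by rewrite cE root_prod_XsubC mem_undup.
apply: (@le_sorted_eq _ _); rewrite ?sort_le_sorted ?sorted_flatten_nseq//.
rewrite perm_sym perm_sort perm_sym.
rewrite -(permPr (perm_count_undup s)) /eigenvalues.
under eq_map do rewrite cE mu_prod_XsubC.
by apply: perm_flatten; rewrite perm_map.
Qed.

Lemma char_poly_conj (F : fieldType) n (P D : 'M[F]_n) : P \in unitmx ->
  char_poly (invmx P *m D *m P) = char_poly D.
Proof.
move=> Pu; rewrite /char_poly.
have VP : map_mx polyC (invmx P) *m map_mx polyC P = 1%:M.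
  by rewrite -map_mxM mulVmx// map_mx1.
have -> : char_poly_mx (invmx P *m D *m P)
    = map_mx polyC (invmx P) *m char_poly_mx D *m map_mx polyC P.
  rewrite /char_poly_mx !map_mxM mulmxBr mulmxBl; congr (_ - _).
  by rewrite -mulmxA -scalar_mxC mulmxA VP mul1mx.
rewrite !det_mulmx mulrAC -det_mulmx.
by rewrite VP det1 mul1r.
Qed.

Local Notation toC := (map_mx (real_complex R)).

(** The spectral theorem is applied to the complexified matrix, whose eigenvalues are real because
    it is Hermitian. Vectors are rows acting from the left, so the rows of [P] are the
    eigenvectors. *)
Theorem symmetric_eigenbasis n (A : 'M[R]_n) : A^T = A ->
  [/\ size (eigenvalues A) = n, sorted <=%R (eigenvalues A) &
    exists2 P : 'M[R[i]]_n, P \is unitarymx &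
      P *m toC A = diag_mx (\row_i ((eigenvalues A)`_i)%:C) *m P].
Proof.
move=> As.
have rA : toC A \is a realmx.
  by apply/mxOverP => i j; rewrite mxE complex_real.
have hA : toC A \is hermsymmx.
  apply: realsym_hermsym rA.
  by apply/is_hermitianmxP; rewrite expr0 scale1r map_mx_id// map_trmx As.
have /orthomx_spectralP := hermitian_normalmx hA.
have := spectral_unitarymx (toC A).
have := hermitian_spectral_diag_real hA.
set P := spectralmx _; set d := spectral_diag _ => rd uP AE.
have Pu := unitarymx_unit uP.
pose e (i : 'I_n) := complex.Re (d 0 i).
have dE i : d 0 i = (e i)%:C by rewrite RRe_real//; exact: (mxOverP rd).
have cE : char_poly A = \prod_(x <- [tuple e i | i < n]) ('X - x%:P).
  apply: (map_poly_inj (real_complex R)).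
  rewrite map_char_poly [toC A]AE char_poly_conj// char_poly_trig ?diag_mx_is_trig//.
  rewrite rmorph_prod /= big_map big_enum /=; apply: eq_bigr => i _.
  by rewrite !mxE eqxx mulr1n dE rmorphB /= map_polyX map_polyC.
have EE := eigenvalues_sort cE.
have sE : size (eigenvalues A) = n by rewrite EE size_sort size_tuple.
split=> //; first by rewrite EE sort_le_sorted.
(* The spectral theorem lists the eigenvalues in no particular order; [s] reorders the rows to match
   the sorted list. *)
have /perm.tuple_permP[s sP] : perm_eq (eigenvalues A) [tuple e i | i < n].
  by rewrite EE perm_sort.
have es (i : 'I_n) : (eigenvalues A)`_i = e (perm.fun_of_perm s i).
  by rewrite sP -[LHS](tnth_nth 0) !tnth_mktuple.
exists (row_perm s P).
  apply/unitarymxP/matrixP => i j.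
  have /unitarymxP/matrixP/(_ (perm.fun_of_perm s i) (perm.fun_of_perm s j)) := uP.
  rewrite !mxE (inj_eq perm.perm_inj) => <-.
  by apply: eq_bigr => k _; rewrite !mxE.
have PA : P *m toC A = diag_mx d *m P by rewrite [in LHS]AE !mulmxA mulmxV// mul1mx.
apply/matrixP => i j.
have /matrixP/(_ (perm.fun_of_perm s i) j) := PA.
rewrite !mul_diag_mx !mxE dE es => <-.
by apply: eq_bigr => k _; rewrite !mxE.
Qed.

End Eigenvalues.

(** * Min-max bounds and Weyl's inequality *)

Section MinMax.
Local Open Scope sesquilinear_scope.
Variable R : rcfType.
Local Notation C := R[i].
Local Notation toC := (map_mx (real_complex R)).
Variable n : nat.
Implicit Types (A B : 'M[R]_n) (x : 'rV[C]_n).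

Definition hform (A : 'M[R]_n) x : C := (x *m toC A *m x^t*) 0 0.

Definition hnorm x : C := \sum_j `|x 0 j| ^+ 2.

Lemma hformE A x :
  hform A x = \sum_i \sum_j (A i j)%:C * (x 0 i * (x 0 j)^*%R).
Proof.
rewrite /hform -mulmxA mxE; apply: eq_bigr => i _.
rewrite mxE mulr_sumr; apply: eq_bigr => j _; rewrite !mxE.
by rewrite mulrCA.
Qed.

Lemma hnormE x : hnorm x = (x *m x^t*) 0 0.
Proof. by rewrite mxE; apply: eq_bigr => i _; rewrite !mxE normCK. Qed.

Lemma hnorm_ge0 x : 0 <= hnorm x.
Proof. by apply: sumr_ge0 => i _; rewrite exprn_ge0. Qed.

Lemma hnorm_gt0 x : x != 0 -> 0 < hnorm x.
Proof.
move=> /rV0Pn[i xi0]; rewrite /hnorm (bigD1 i)//= ltr_pwDl ?exprn_gt0 ?normr_gt0//.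
by apply: sumr_ge0 => j _; rewrite exprn_ge0.
Qed.

Lemma hform_bound A x :
  `|hform A x| <= (\sum_i \sum_j `|A i j|)%:C * hnorm x.
Proof.
rewrite hformE (le_trans (ler_norm_sum _ _ _))// rmorph_sum mulr_suml.
apply: ler_sum => i _; rewrite (le_trans (ler_norm_sum _ _ _))//.
rewrite rmorph_sum mulr_suml; apply: ler_sum => j _ /=.
rewrite !normrM norm_conjC (_ : `|(A i j)%:C| = `|A i j|%:C); last first.
  by rewrite normc_def /= expr0n /= addr0 sqrtr_sqr.
apply: ler_wpM2l; first by rewrite ler0c.
have hx k : `|x 0 k| ^+ 2 <= hnorm x.
  rewrite /hnorm (bigD1 k)//= lerDl.
  by apply: sumr_ge0 => l _; rewrite exprn_ge0.
have [le|le] := real_leP (normr_real (x 0 i)) (normr_real (x 0 j)).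
  by rewrite (le_trans _ (hx j))// expr2 ler_wpM2r.
by rewrite (le_trans _ (hx i))// expr2 ler_wpM2l// ltW.
Qed.

Section Spectral.
Variables (A : 'M[R]_n) (P : 'M[C]_n) (d : 'I_n -> R).
Hypotheses (uP : P \is unitarymx)
  (PA : P *m toC A = diag_mx (\row_i (d i)%:C) *m P).

Lemma hnorm_spectral x : hnorm x = hnorm (x *m P^t*).
Proof.
rewrite !hnormE trmx_mul map_mxM /= trmxCK mulmxA.
by rewrite mulmxKtV.
Qed.

Lemma hform_spectral x :
  hform A x = \sum_i (d i)%:C * `|(x *m P^t*) 0 i| ^+ 2.
Proof.
have -> : hform A x
    = (x *m P^t* *m diag_mx (\row_i (d i)%:C) *m (x *m P^t*)^t*) 0 0.
  rewrite /hform trmx_mul map_mxM /= trmxCK !mulmxA.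
  by rewrite -(mulmxA _ _ P) -PA mulmxA mulmxKtV.
rewrite mxE; apply: eq_bigr => i _; rewrite mul_mx_diag !mxE normCK.
by rewrite mulrAC mulrC.
Qed.

End Spectral.

(** Dimension count: fewer than [k] linear conditions on a space of dimension [k] leave a nonzero
    vector. *)
Lemma avoid_coords k (U : 'M[C]_(k, n)) (P : 'M[C]_n) (I : {pred 'I_n}) :
  row_free U -> (#|I| < k)%N ->
  exists y : 'rV_k, y *m U != 0 /\ forall i, i \in I -> (y *m U *m P) 0 i = 0.
Proof.
move=> fU ltk; pose M := colsub (enum_val : 'I_#|I| -> 'I_n) (U *m P).
have : kermx M != 0.
  rewrite -mxrank_eq0 mxrank_ker subn_eq0 -ltnNge.
  exact: leq_ltn_trans (rank_leq_col M) ltk.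
move=> /rowV0Pn[y /sub_kermxP yM y0]; exists y; split.
  by rewrite mulmx_free_eq0.
move=> i iI.
have -> : (y *m U *m P) 0 i = (y *m M) 0 (enum_rank_in iI i).
  rewrite -mulmxA [LHS]mxE [RHS]mxE; apply: eq_bigr => l _; congr (_ * _).
  by rewrite [RHS]mxE enum_rankK_in.
by rewrite yM mxE.
Qed.

Lemma card_ord_gt (i : nat) : #|[pred j : 'I_n | (i < j)%N]| = (n - i.+1)%N.
Proof.
rewrite -sum1_card -(big_geq_mkord i.+1 n xpredT (fun=> 1%N)).
by rewrite sum_nat_const_nat muln1.
Qed.

Lemma card_ord_lt (i : 'I_n) : #|[pred j : 'I_n | (j < i)%N]| = i.
Proof.
have := cardC [pred j : 'I_n | (i.-1 < j)%N]; rewrite card_ord_gt card_ord.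
have := ltn_ord i; case: (posnP i) => [-> _ _|i0 lti].
  by rewrite eq_card0.
rewrite prednK// => E.
rewrite (_ : #|_| = #|[predC [pred j : 'I_n | (i <= j)%N]]|).
  apply/eqP; rewrite -(eqn_add2l (n - i)) E subnK//; exact: ltnW.
by apply: eq_card => j; rewrite !inE -ltnNge.
Qed.

(** One half of the Courant-Fischer principle. The row space of [U] meets the span of the
    eigenvectors of index at most [i], where the form is at most the [i]-th eigenvalue times the
    squared norm. *)
Lemma eigenvalues_ge A k (U : 'M[C]_(k, n)) (al : R) (i : 'I_n) : A^T = A ->
  row_free U -> (n <= i + k)%N ->
  (forall y : 'rV_k, al%:C * hnorm (y *m U) <= hform A (y *m U)) ->
  al <= (eigenvalues A)`_i.
Proof.
move=> As fU leik hU; have [sE so [P uP PA]] := symmetric_eigenbasis As.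
rewrite leNgt; apply/negP => lt.
have [|y [x0 hx]] := @avoid_coords k U (P^t*) [pred j : 'I_n | (i < j)%N] fU.
  rewrite card_ord_gt (leq_trans _ (_ : n - i <= k)%N)//; last by rewrite leq_subLR.
  by rewrite subnS prednK ?subn_gt0.
set x := y *m U in x0 hx.
have : hform A x < al%:C * hnorm x; last by rewrite le_gtF// hU.
apply: (@le_lt_trans _ _ (((eigenvalues A)`_i)%:C * hnorm x)); last first.
  by rewrite ltr_pM2r ?hnorm_gt0// ltcR.
rewrite (hform_spectral uP PA) (hnorm_spectral uP) mulr_sumr.
apply: ler_sum => j _; have [lij|lji] := ltnP i j.
  by rewrite hx// normr0 expr0n /= !mulr0.
rewrite ler_wpM2r ?exprn_ge0// lecR.
by rewrite (sorted_leq_nth le_trans)// ?inE ?sE//; exact: le_refl.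
Qed.

(** The other half: the row space of [U] now meets the span of the eigenvectors of index at least
    [i]. *)
Lemma eigenvalues_le A k (U : 'M[C]_(k, n)) (al : R) (i : 'I_n) : A^T = A ->
  row_free U -> (i < k)%N ->
  (forall y : 'rV_k, hform A (y *m U) <= al%:C * hnorm (y *m U)) ->
  (eigenvalues A)`_i <= al.
Proof.
move=> As fU leik hU; have [sE so [P uP PA]] := symmetric_eigenbasis As.
rewrite leNgt; apply/negP => lt.
have [|y [x0 hx]] := @avoid_coords k U (P^t*) [pred j : 'I_n | (j < i)%N] fU.
  by rewrite card_ord_lt.
set x := y *m U in x0 hx.
have : al%:C * hnorm x < hform A x; last by rewrite le_gtF// hU.
apply: (@lt_le_trans _ _ (((eigenvalues A)`_i)%:C * hnorm x)).
  by rewrite ltr_pM2r ?hnorm_gt0// ltcR.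
rewrite (hform_spectral uP PA) (hnorm_spectral uP) mulr_sumr.
apply: ler_sum => j _; have [lij|lji] := ltnP j i.
  by rewrite hx// normr0 expr0n /= !mulr0.
rewrite ler_wpM2r ?exprn_ge0// lecR.
by rewrite (sorted_leq_nth le_trans)// ?inE ?sE//; exact: le_refl.
Qed.

Lemma hformB A B x : hform A x = hform B x + hform (A - B) x.
Proof.
by rewrite /hform [toC (A - B)]map_mxB mulmxBr mulmxBl [X in _ + X]mxE
  [X in _ + (_ + X)]mxE addrC subrK.
Qed.

(** The test space for [A] is spanned by the eigenvectors of [B] of index at least [i]; on it the
    form of [B] is bounded below, and [hform_bound] controls the form of [A - B]. *)
Lemma weyl_le A B (i : 'I_n) : A^T = A -> B^T = B ->
  (eigenvalues B)`_i - \sum_k \sum_l `|A k l - B k l| <= (eigenvalues A)`_i.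
Proof.
move=> As Bs; have [sE so [P uP PB]] := symmetric_eigenbasis Bs.
have fP (k : 'I_(n - i)) : (i + k < n)%N by rewrite -ltn_subRL.
pose f k := Ordinal (fP k).
have f_inj : injective f by move=> k l [] /addnI /val_inj.
pose U := rowsub f P.
have UP : U *m P^t* = rowsub f 1%:M.
  by rewrite /U mul_rowsub_mx (unitarymxP _).
have fU : row_free U.
  rewrite /row_free mxrank_unitary//; apply/unitarymxP/matrixP => k l.
  have /unitarymxP/matrixP/(_ (f k) (f l)) := uP.
  rewrite !mxE (inj_eq f_inj) => <-.
  by apply: eq_bigr => m _; rewrite !mxE.
apply: (eigenvalues_ge As fU); first by rewrite subnKC// ltnW.
move=> y; set x := y *m U.
rewrite (hformB A B) rmorphB mulrBl lerD//.
  rewrite (hform_spectral uP PB) (hnorm_spectral uP) mulr_sumr.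
  apply: ler_sum => j _; have [lij|lji] := ltnP j i.
    rewrite (_ : (x *m P^t*) 0 j = 0) ?normr0 ?expr0n /= ?mulr0//.
    rewrite /x -mulmxA UP mxE big1// => k _; rewrite !mxE.
    rewrite (_ : (f k == j) = false) ?mulr0//.
    by apply/eqP => E; rewrite -E /= ltnNge leq_addr in lij.
  rewrite ler_wpM2r ?exprn_ge0// lecR.
  by rewrite (sorted_leq_nth le_trans)// ?inE ?sE//; exact: le_refl.
have := hform_bound (A - B) x.
(* The form takes complex values; diagonalizing [A - B] shows that this one is real, so the bound on
   its modulus gives a lower bound. *)
have hr : hform (A - B) x \is Num.real.
  have ABs : (A - B)^T = A - B by rewrite linearB /= As Bs.
  have [_ _ [P' uP' PAB]] := symmetric_eigenbasis ABs.
  rewrite (hform_spectral uP' PAB) rpred_sum// => k _.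
  by apply: rpredM; [rewrite complex_real | exact/rpredX/normr_real].
rewrite real_ler_norml// => /andP[+ _]; apply: le_trans.
rewrite lerN2 ler_wpM2r ?hnorm_ge0// lecR.
by apply: ler_sum => k _; apply: ler_sum => l _; rewrite !mxE.
Qed.

Lemma weyl A B (i : 'I_n) : A^T = A -> B^T = B ->
  `|(eigenvalues A)`_i - (eigenvalues B)`_i| <= \sum_k \sum_l `|A k l - B k l|.
Proof.
move=> As Bs; rewrite ler_norml lerBrDr addrC weyl_le//= lerBlDr.
rewrite -lerBlDl (le_trans _ (weyl_le i Bs As))// lerB//.
by apply: ler_sum => k _; apply: ler_sum => l _; rewrite distrC.
Qed.

End MinMax.

(** * The Jacobi matrices *)

Section Expi.
Variable R : realType.
Implicit Types x y : R.

Lemma expiD x y : expi (x + y) = expi x * expi y.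
Proof.
rewrite /expi cosD sinD; apply/eqP; rewrite eq_complex /= eqxx /=.
by rewrite addrC eqxx.
Qed.

Lemma expi0 : expi (0 : R) = 1.
Proof. by rewrite /expi cos0 sin0. Qed.

Lemma expiNK x : expi (- x) * expi x = 1.
Proof. by rewrite -expiD addNr expi0. Qed.

Lemma expi_neq0 x : expi x != 0.
Proof.
by apply/eqP => E; have := expiNK x; rewrite E mulr0 => /esym/eqP; rewrite oner_eq0.
Qed.

Lemma expiDN x : expi x + expi (- x) = (2 * cos x)%:C.
Proof.
rewrite /expi cosN sinN; apply/eqP; rewrite eq_complex /= subrr eqxx andbT.
by rewrite mulrDl !mul1r.
Qed.

Lemma norm_expi x : `|expi x| = 1.
Proof. by rewrite normc_def /= cos2Dsin2 sqrtr1. Qed.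

End Expi.

Section JacobiSpectrum.
Local Open Scope sesquilinear_scope.
Variables (R : realType) (N : nat) (b : R) (v : 'I_(width N) -> R).
Local Notation C := R[i].
Local Notation toC := (map_mx (real_complex R)).
Implicit Types (t : R) (u : 'rV[C]_(width N)).

Lemma Jacobi_sym t : (Jacobi b v t)^T = Jacobi b v t.
Proof.
apply/matrixP => i j; rewrite !mxE eq_sym; case: eqP => [->//|ij].
by case: eqP => [E|_]; case: eqP => [E'|_] //; lia.
Qed.

(** The zero past the end is the right boundary condition: it spares the last row a separate case
    and closes the recurrence at index [width N]. *)
Definition extend u (m : nat) : C := if (m < width N)%N then u 0 (inord m) else 0.

Lemma extend_ord u (j : 'I_(width N)) : extend u j = u 0 j.
Proof. by rewrite /extend ltn_ord inord_val. Qed.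

Lemma extend_sum u (m : nat) (w : C) :
  \sum_(i < width N) (if (i == m :> nat) then u 0 i * w else 0) = extend u m * w.
Proof.
rewrite -big_mkcond /= /extend; case: ltnP => [ltm|lem].
  rewrite (big_pred1 (inord m))// => i /=.
  by apply/eqP/eqP => [<-|->]; rewrite ?inord_val ?inordK.
by rewrite mul0r big_pred0// => i; apply/eqP; have := ltn_ord i; lia.
Qed.

Lemma Jacobi_row t u (j : 'I_(width N)) :
  (u *m toC (Jacobi b v t)) 0 j =
    (if (0 < j)%N then extend u j.-1 * (offdiag b t j)%:C else 0)
    + extend u j * (v j)%:C + extend u j.+1 * (offdiag b t j.+1)%:C.
Proof.
rewrite mxE.
have -> : (if (0 < j)%N then extend u j.-1 * (offdiag b t j)%:C else 0) =
   \sum_(i < width N) if (j == i.+1 :> nat) then u 0 i * (offdiag b t j)%:C else 0.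
  case: ltnP => [j0|]; last first.
    by rewrite leqn0 => /eqP ->; rewrite big1.
  rewrite -extend_sum; apply: eq_bigr => i _.
  by rewrite (_ : (j == i.+1 :> nat) = (i == j.-1 :> nat))//; apply/eqP/eqP; lia.
rewrite -!extend_sum -!big_split /=; apply: eq_bigr => i _; rewrite !mxE.
have [->|nij] := eqVneq i j.
  by rewrite eqxx; case: eqP => [|_]; [lia|]; rewrite add0r addr0.
rewrite (_ : (i == j :> nat) = false); last by apply/negbTE.
rewrite addr0; case: eqP => [E|_].
  by case: eqP => [E'|_]; [lia|]; rewrite addr0 E.
by case: eqP => _; rewrite add0r// mulr0.
Qed.

Lemma extend_inj u : (forall m, (m < width N)%N -> extend u m = 0) -> u = 0.
Proof. by move=> h; apply/rowP => j; rewrite mxE -extend_ord h. Qed.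

Let E t := eigenvalues (Jacobi b v t).

Lemma eigenvalues_nth_le t (i j : nat) :
  (i <= j)%N -> (j < width N)%N -> (E t)`_i <= (E t)`_j.
Proof.
move=> ij jn; have [sE so _] := symmetric_eigenbasis (Jacobi_sym t).
have ltin := leq_ltn_trans ij jn.
by rewrite (sorted_leq_nth le_trans)// ?inE ?sE//; exact: le_refl.
Qed.

Lemma eigenvalues_nth_vector t (i : nat) : (i < width N)%N ->
  exists2 u : 'rV[C]_(width N), u != 0 &
    u *m toC (Jacobi b v t) = ((E t)`_i)%:C *: u.
Proof.
move=> ltn; have [sE so [P uP PE]] := symmetric_eigenbasis (Jacobi_sym t).
pose i' := Ordinal ltn; exists (row i' P).
  apply/eqP => r0; have : row i' (P *m P^t*) = 0 by rewrite row_mul r0 mul0mx.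
  rewrite (unitarymxP _)// => /rowP/(_ i'); rewrite !mxE eqxx => /eqP.
  by rewrite oner_eq0.
rewrite -row_mul PE; apply/rowP => j; rewrite !mul_diag_mx !mxE //.
Qed.

(** * The spectrum when all odd sites carry the same potential *)

Section FlatBand.
Variable c : R.
Hypothesis vc : forall j : 'I_(width N), ~~ odd j -> v j = c.

(** The couplings join only indices of opposite parity, so on the span of the [N.+1] coordinate
    vectors of even index the form is [c] times the squared norm. Since [width N] is [N + N.+1],
    both min-max bounds apply at index [N]. *)
Lemma middle_eigenvalue t : (E t)`_N = c.
Proof.
pose U : 'M[C]_(N.+1, width N) := \matrix_(k, j) (j == k.*2 :> nat)%:R.
have fU : row_free U.
  apply/row_freeP; exists (U^T); apply/matrixP => k l; rewrite !mxE.
  have kP : (k.*2 < width N)%N by rewrite /width; have := ltn_ord k; lia.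
  rewrite (bigD1 (Ordinal kP))//= !mxE /= eqxx mul1r big1 => [|j /negbTE jk].
    by rewrite addr0 (inj_eq double_inj).
  by rewrite !mxE -(inj_eq val_inj) /= in jk *; rewrite jk mul0r.
have hU (y : 'rV_N.+1) :
    hform (Jacobi b v t) (y *m U) = c%:C * hnorm (y *m U).
  set x := y *m U.
  have x0 (j : 'I_(width N)) : odd j -> x 0 j = 0.
    move=> oj; rewrite mxE big1// => k _; rewrite mxE.
    by case: eqP => [H|_]; [rewrite H odd_double in oj|rewrite mulr0].
  rewrite hformE mulr_sumr; apply: eq_bigr => i _.
  have [oi|ei] := boolP (odd i).
    by rewrite x0// normr0 expr0n /= mulr0 big1// => j _; rewrite mul0r mulr0.
  rewrite (bigD1 i)//= mxE eqxx vc// normCK big1 ?addr0// => j ji.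
  have [oj|ej] := boolP (odd j); first by rewrite (x0 _ oj) conjC0 !mulr0.
  rewrite mxE eq_sym (negbTE ji); case: eqP => [H|_].
    by rewrite H /= ei in ej.
  by case: eqP => [H|_]; [rewrite H /= ej in ei | rewrite mul0r].
have ltN : (N < width N)%N by rewrite /width; lia.
apply/eqP; rewrite eq_le; apply/andP; split.
  apply: (@eigenvalues_le _ _ _ _ U c (Ordinal ltN) (Jacobi_sym t) fU) => // y.
  by rewrite hU.
apply: (@eigenvalues_ge _ _ _ _ U c (Ordinal ltN) (Jacobi_sym t) fU) => [/=|y].
  by rewrite /width; lia.
by rewrite hU.
Qed.

(** The couplings of odd number may vanish, so the recurrence is only ever solved across those equal
    to 1. This dictates the direction of each of the two inductions. *)
Lemma kernel_first_coord t u :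
  u *m toC (Jacobi b v t) = c%:C *: u -> extend u 0 = 0 -> u = 0.
Proof.
move=> uJ u0.
have row m : (m < width N)%N ->
    (if (0 < m)%N then extend u m.-1 * (offdiag b t m)%:C else 0)
    + extend u m * (entry v m.+1)%:C + extend u m.+1 * (offdiag b t m.+1)%:C
    = c%:C * extend u m.
  move=> ltm; have := Jacobi_row t u (inord m).
  by rewrite uJ mxE -extend_ord /entry /= !inordK// => <-.
have ve k : (k <= N)%N -> entry v k.*2.+1 = c.
  by move=> le; apply: vc; rewrite inordK /= ?odd_double// /width; lia.
(* The even rows, whose diagonal term cancels, propagate zero leftwards through the odd coordinates,
   starting from the zero past the end. *)
have od k : (k <= N)%N -> extend u k.*2.+1 = 0.
  move=> kN; rewrite -(subKn kN); elim: (N - k)%N (leq_subr k N) => [_|l IH lN].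
    by rewrite subn0 /extend ltnn.
  have lt1 : ((N - l).*2 < width N)%N by rewrite /width; lia.
  have := row _ lt1; rewrite ve ?leq_subr//.
  rewrite (IH (ltnW lN)) mul0r addr0 [c%:C * _]mulrC.
  rewrite (_ : (0 < _)%N) ?double_gt0 ?subn_gt0//.
  rewrite (_ : _.-1 = (N - l.+1).*2.+1); last by lia.
  move=> /(canRL (addrK _)) /eqP; rewrite subrr mulf_eq0.
  by rewrite /offdiag odd_double oner_eq0 orbF => /eqP.
(* The odd rows then propagate zero rightwards from the first coordinate. *)
have ev k : (k <= N)%N -> extend u k.*2 = 0.
  elim: k => [//|k IH] kN.
  have lt1 : (k.*2.+1 < width N)%N by rewrite /width; lia.
  have := row _ lt1; rewrite /= od ?IH ?(ltnW kN)// !mul0r mulr0 !add0r.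
  by rewrite /offdiag /= odd_double /= mulr1.
apply: extend_inj => m ltm; rewrite -(odd_double_half m).
have mN : (m./2 <= N)%N by rewrite /width in ltm; lia.
by case: odd => /=; rewrite ?add1n ?add0n ?od ?ev.
Qed.

(** Two orthonormal eigenvectors for [c] have a combination [w *m P] with first coordinate zero,
    which [kernel_first_coord] forces to vanish. *)
Lemma middle_eigenvalue_simple t (i j : nat) : (i < j)%N -> (j < width N)%N ->
  (E t)`_i = c -> (E t)`_j = c -> False.
Proof.
move=> ltij ltj Ei Ej; have [sE so [P uP PE]] := symmetric_eigenbasis (Jacobi_sym t).
have lti := ltn_trans ltij ltj.
pose i' := Ordinal lti; pose j' := Ordinal ltj.
have ker (k : 'I_(width N)) : (E t)`_k = c ->
    row k P *m toC (Jacobi b v t) = c%:C *: row k P.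
  by move=> Ek; rewrite -row_mul PE; apply/rowP => l; rewrite mul_diag_mx !mxE -Ek.
pose w : 'rV_(width N) := P j' 0 *: delta_mx 0 i' - P i' 0 *: delta_mx 0 j'.
have wP : w *m P = P j' 0 *: row i' P - P i' 0 *: row j' P.
  by rewrite mulmxBl -!scalemxAl -!rowE.
have wP0 : w *m P = 0.
  apply: (@kernel_first_coord t).
    by rewrite wP mulmxBl -!scalemxAl !ker// scalerBr !scalerA ![_ * c%:C]mulrC.
  rewrite wP (extend_ord _ ord0) !mxE mulrC subrr //.
have w0 : w = 0 by rewrite -[w](mulmxtVK w uP) wP0 mul0mx.
(* The coefficients of [w] are the first coordinates of the two eigenvectors; their vanishing makes
   row [j'] itself zero, against unitarity. *)
have Pj0 : P j' 0 = 0.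
  have /rowP/(_ i') := w0; rewrite !mxE !eqxx /= mulr1.
  rewrite (_ : (i' == j') = false) ?mulr0 ?subr0//.
  by apply/eqP => -[] E'; rewrite E' ltnn in ltij.
have rj : row j' P = 0.
  apply: (@kernel_first_coord t); first exact: ker.
  by rewrite (extend_ord _ ord0) mxE.
have : row j' (P *m P^t*) = 0 by rewrite row_mul rj mul0mx.
rewrite (unitarymxP _)// => /rowP/(_ j'); rewrite !mxE eqxx => /eqP.
by rewrite oner_eq0.
Qed.

Lemma upper_eigenvalue t (n : nat) : (0 < n <= N)%N -> c < (E t)`_(N + n).
Proof.
move=> /andP[n0 nN]; have lt : (N + n < width N)%N by rewrite /width; lia.
rewrite lt_neqAle -{2}(middle_eigenvalue t) eigenvalues_nth_le ?leq_addr// andbT.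
apply/eqP => /esym H; apply: middle_eigenvalue_simple lt (middle_eigenvalue t) H.
lia.
Qed.

Lemma lower_eigenvalue t (n : nat) : (0 < n <= N)%N -> (E t)`_(N - n) < c.
Proof.
move=> /andP[n0 nN]; have lt : (N < width N)%N by rewrite /width; lia.
rewrite lt_neqAle -{2}(middle_eigenvalue t) eigenvalues_nth_le ?leq_subr// andbT.
apply/eqP => H; apply: middle_eigenvalue_simple lt H (middle_eigenvalue t).
lia.
Qed.

End FlatBand.
End JacobiSpectrum.

(** * Continuity and nonconstancy of the eigenvalues in [t] *)

Section Bands.
Variables (R : realType) (N : nat) (b : R) (v : 'I_(width N) -> R).
Local Notation C := R[i].
Local Notation toC := (map_mx (real_complex R)).

Lemma continuous_offdiag n : continuous (fun t : R => offdiag b t n).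
Proof.
rewrite /offdiag; case: odd => [|t]; last exact: cvg_cst.
pose g (t : R) := t / 2 - ((3 * n)%:R - 2) / 2 * b.
have gc : continuous g.
  move=> t; apply: cvgB; last exact: cvg_cst.
  by apply: cvgMl; exact: cvg_id.
move=> t; apply: cvgMr; apply: cvg_norm.
exact: (@continuous_comp _ _ _ g cos t (gc t) (@continuous_cos R (g t))).
Qed.

Lemma continuous_Jacobi i j : continuous (fun t => Jacobi b v t i j).
Proof.
rewrite (_ : (fun t => _) = fun t => if i == j then v i
    else if j == i.+1 :> nat then offdiag b t i.+1
    else if i == j.+1 :> nat then offdiag b t j.+1
    else 0); last by apply/funext => t; rewrite mxE.
case: eqP => [_|_]; first by move=> t; exact: cvg_cst.
case: eqP => [_|_]; first exact: continuous_offdiag.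
by case: eqP => [_|_]; [exact: continuous_offdiag | move=> t; exact: cvg_cst].
Qed.

(** By [weyl] the increment is at most the entrywise distance [d], which is continuous and vanishes
    at [t]. *)
Lemma continuous_eigenvalue (i : nat) : (i < width N)%N ->
  continuous (fun t => (eigenvalues (Jacobi b v t))`_i).
Proof.
move=> lti t; apply/cvgrPdist_le => e e0.
pose d s := \sum_k \sum_l `|Jacobi b v t k l - Jacobi b v s k l|.
have dc : continuous (d : R -> R).
  apply: continuous_big => [|k _]; first exact: add_continuous.
  apply: continuous_big => [|l _ s]; first exact: add_continuous.
  apply: (@cvg_norm _ R^o).
  by apply: cvgB; [exact: cvg_cst | exact: continuous_Jacobi].
have d0 : d t = 0.
  by rewrite /d big1// => k _; rewrite big1// => l _; rewrite subrr normr0.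
have /cvgrPdist_le/(_ e e0) := dc t; apply: filterS => s.
rewrite d0 sub0r normrN => le; apply: le_trans (weyl (Ordinal lti) _ _) _;
  rewrite ?Jacobi_sym//.
exact: le_trans (ler_norm _) le.
Qed.

(** At the point [expi t] of the unit circle this is [expi t] times the squared modulus of
    [1 + expi (t - phi)]: a squared coupling made polynomial. *)
Definition band_quadratic (phi : R) : {poly C} :=
  expi (- phi) *: 'X^2 + 2 *: 'X + (expi phi)%:P.

Lemma size_band_quadratic phi : size (band_quadratic phi) = 3%N.
Proof.
rewrite /band_quadratic -addrA size_polyDl size_scale ?expi_neq0 ?size_polyXn//.
rewrite (leq_ltn_trans (size_polyD _ _))// gtn_max.
rewrite (leq_ltn_trans (size_scale_leq _ _)) ?size_polyX//=.
by rewrite (leq_ltn_trans (size_polyC_leq1 _)).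
Qed.

Lemma band_quadratic_expi phi t :
  (band_quadratic phi).[expi t] = expi t * (2 + 2 * cos (t - phi))%:C.
Proof.
rewrite rmorphD /= -expiDN opprB !expiD /band_quadratic !hornerE.
have := expiNK t; have -> : 2%:C = 2 :> C by rewrite rmorph_nat.
move: (expi t) (expi (- t)) => z w zw.
rewrite /=.
apply: etrans (_ : _ = expi (- phi) * (z * z) + 2 * z + expi phi * (w * z)) _.
  by rewrite zw; ring.
by ring.
Qed.

Definition coupling_phase (k : nat) : R := ((3 * k.*2.+1)%:R - 2) * b.

Lemma offdiag_sqr k t :
  offdiag b t k.*2.+1 ^+ 2 = 2 + 2 * cos (t - coupling_phase k).
Proof.
rewrite /offdiag /= odd_double /= exprMn real_normK ?num_real//.
have -> : t - coupling_phase k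
    = (t / 2 - ((3 * k.*2.+1)%:R - 2) / 2 * b) *+ 2.
  by rewrite /coupling_phase; field.
by rewrite cos_mulr2n; ring.
Qed.

(** A nonzero polynomial has fewer roots than its size. The test angles [k.+1%:R^-1] lie in
    [[0, 1]], where cosine is injective, so the points are already told apart by their real
    parts. *)
Lemma expi_roots_eq0 (p : {poly C}) :
  (forall t : R, 0 <= t <= 2 * pi -> p.[expi t] = 0) -> p = 0.
Proof.
move=> h; apply/eqP/negPn/negP => p0.
pose rs := [seq expi (k.+1%:R^-1 : R) | k <- iota 0 (size p)].
have k01 (k : nat) : 0 <= (k.+1%:R^-1 : R) <= 1.
  by rewrite invr_ge0 ler0n /= invf_le1 ?ltr0Sn// ler1n.
have pi1 : 1 <= pi :> R.
  by rewrite (le_trans _ (pi_ge2 R))// ler1n.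
have := @max_poly_roots _ p rs p0; rewrite size_map size_iota ltnn => H.
suff : false by []; apply: H.
  apply/allP => _ /mapP[k _ ->]; apply/rootP/h.
  case/andP: (k01 k) => -> /le_trans -> //; lra.
rewrite map_inj_in_uniq ?iota_uniq// => k l _ _ [].
move=> /cos_inj E _; have {}E := E _ _.
have /eqP : k.+1%:R^-1 = l.+1%:R^-1 :> R.
  by apply: E; rewrite in_itv /=; [case/andP: (k01 k)|case/andP: (k01 l)];
    move=> -> /le_trans ->.
by rewrite (inj_eq invr_inj) eqr_nat eqSS => /eqP.
Qed.

(* The rows of even index are multiplied by [z = expi t], which makes the
   products of opposite couplings polynomials in [z]. *)
Lemma constant_eigenvalue (lam : R) :
  (forall t : R, 0 <= t <= 2 * pi -> exists2 u : 'rV[C]_(width N), u != 0 &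
     u *m toC (Jacobi b v t) = lam%:C *: u) ->
  lam = entry v 1.
Proof.
move=> hlam.
pose c m : C := (entry v m.+1 - lam)%:C.
pose W k := band_quadratic (coupling_phase k).
have sW k : size (W k) = 3%N by exact: size_band_quadratic.
pose Q := continuant (band_diag c) (band_prod W) (width N).
suff Q0 : Q = 0.
  have := continuant_eq0 sW Q0 (leq0n N).
  rewrite /c -(rmorph0 (real_complex R)) => /complexI/eqP.
  by rewrite subr_eq0 => /eqP.
have W0 k : W k != 0 by rewrite -size_poly_gt0 sW.
(* Where a coupling vanishes, an eigenvector may have first coordinate zero and then gives no
   information on [Q]; the extra factors vanish at such [t]. *)
suff /eqP : Q * \prod_(k < N.+1) W k = 0.
  rewrite mulf_eq0 => /orP[/eqP//|].
  by rewrite prodf_seq_eq0 => /hasP[k _] /=; rewrite (negbTE (W0 k)).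
apply: expi_roots_eq0 => t ht; have [u u0 uJ] := hlam t ht.
pose z := expi t.
pose a m : C := if odd m then c m else c m * z.
pose up m : C := if odd m then 1 else z * (offdiag b t m.+1)%:C.
pose lo m : C := if odd m then z else (offdiag b t m.+1)%:C.
have row m : (m < width N)%N ->
    (if (0 < m)%N then extend u m.-1 * (offdiag b t m)%:C else 0)
    + extend u m * (c m) + extend u m.+1 * (offdiag b t m.+1)%:C = 0.
  move=> ltm; have := Jacobi_row b v t u (inord m).
  rewrite uJ mxE -extend_ord !inordK// /c /entry /= => E.
  rewrite rmorphB /= mulrBr.
  move: E; set X := if _ then _ else _; move=> /eqP; rewrite -subr_eq0 => /eqP E.
  by rewrite -[RHS]oppr0 -[in RHS]E; ring.
have w0 : (0 < width N)%N by [].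
have r0 : a 0%N * extend u 0 + up 0%N * extend u 1 = 0.
  have /(congr1 ( *%R z)) := row 0%N w0; rewrite mulr0 => <- /=.
  by rewrite /a /up /=; ring.
have rS m : (m.+1 < width N)%N ->
    lo m * extend u m + a m.+1 * extend u m.+1 + up m.+1 * extend u m.+2 = 0.
  move=> ltm; have /= := row _ ltm; rewrite /lo /a /up /=.
  case: (boolP (odd m)) => om /=.
    move=> /(congr1 ( *%R z)); rewrite mulr0 => <-.
    by rewrite {2}/offdiag /= om /=; ring.
  by move=> <-; rewrite {3}/offdiag /= (negbTE om) /=; ring.
have S := @continuant_solve C C^o (width N) a up lo (extend u) w0 r0 rS.
have QE : Q.[z] = continuant a (fun i => lo i * up i) (width N).
  rewrite /Q continuant_horner; congr (continuant _ _ _); apply/funext => m.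
    by rewrite /band_diag /a; case: odd; rewrite !hornerE.
  rewrite /band_prod /lo /up; case: (boolP (odd m)) => om.
    by rewrite hornerX mulr1.
  rewrite /W band_quadratic_expi -offdiag_sqr.
  rewrite (_ : m./2.*2 = m); last by rewrite -[RHS]odd_double_half (negbTE om).
  by rewrite rmorphXn /= /z; ring.
rewrite hornerM horner_prod; have [u00|u00] := eqVneq (extend u 0) 0; last first.
  have := S _ (leqnn _); rewrite {1}/extend ltnn scaler0 -QE => /esym/eqP.
  by rewrite scaler_eq0 (negbTE u00) orbF => /eqP ->; rewrite mul0r.
suff [k kN ->] : exists2 k : 'I_N.+1, true & \prod_(k < N.+1) (W k).[expi t] = 0.
  by rewrite mulr0.
have [m um] : exists m, extend u m != 0.
  apply: contrapT => /forallNP H; move/eqP: u0; apply; apply: extend_inj => m _.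
  by apply/eqP/negPn/negP; exact: H.
have ltm : (m < width N)%N by move: um; rewrite /extend; case: ifP; rewrite ?eqxx.
(* At a nonzero coordinate [m] the solved recurrence reads zero on the right, so some [up i] with
   [i < m] is zero, which means a vanishing coupling. *)
have := S _ (ltnW ltm); rewrite u00 scaler0 => /eqP.
rewrite scaler_eq0 (negbTE um) orbF => /prodf_eq0[i _].
rewrite /up; case: (boolP (odd i)) => oi; first by rewrite oner_eq0.
rewrite mulf_eq0 (negbTE (expi_neq0 _)) /= => /eqP oi0.
have iN : (i./2 < N.+1)%N by have := ltn_ord i; rewrite /width in ltm; lia.
exists (Ordinal iN) => //; rewrite (bigD1 (Ordinal iN))//=.
rewrite /W band_quadratic_expi -offdiag_sqr.
rewrite (_ : i./2.*2 = i); last by rewrite -[RHS]odd_double_half (negbTE oi).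
by rewrite rmorphXn /= oi0 expr0n /= mulr0 mul0r.
Qed.

(** By the intermediate value theorem the image contains a nondegenerate interval; it is compact,
    hence measurable, so monotonicity of the measure applies. *)
Lemma image_segment_measure (f : R -> R) (x y : R) : x <= y -> continuous f ->
  (exists s t, [/\ s \in `[x, y], t \in `[x, y] & f s != f t]) ->
  (0 < lebesgue_measure (f @` `[x, y]))%E.
Proof.
move=> xy fc [s [t [sI tI fst]]].
wlog lst : s t sI tI fst / f s < f t.
  move=> H; have [lt|lt|E] := ltgtP (f s) (f t); first exact: H lt.
    by apply: H lt; rewrite // eq_sym.
  by rewrite E eqxx in fst.
have sub : `[f s, f t] `<=` f @` `[x, y].
  move=> z /=; rewrite in_itv /= => /andP[sz zt].
  suff [w /andP[w1 w2] <-] : exists2 w, Num.min s t <= w <= Num.max s t & f w = z.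
    exists w => //=; rewrite !in_itv /= in sI tI *.
    move/andP: sI => [s1 s2]; move/andP: tI => [t1 t2].
    rewrite (le_trans _ w1) ?le_min ?s1 ?t1//=.
    by rewrite (le_trans w2)// ge_max s2 t2.
  have [st|ts] := leP s t.
    have [|w] := @IVT R f s t z st (continuous_subspaceT fc).
      by rewrite (min_idPl (ltW lst)) (max_idPr (ltW lst)) sz zt.
    by rewrite in_itv /= => ? ?; exists w.
  have [|w] := @IVT R f t s z (ltW ts) (continuous_subspaceT fc).
    by rewrite (min_idPr (ltW lst)) (max_idPl (ltW lst)) sz zt.
  by rewrite in_itv /= => ? ?; exists w.
apply: (@lt_le_trans _ _ (lebesgue_measure `[f s, f t]%classic)).
  by rewrite lebesgue_measure_itv /= lte_fin lst -EFinB lte_fin subr_gt0.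
apply: le_measure => //; rewrite in_setE//.
apply: compact_measurable.
apply: continuous_compact (@segment_compact _ _ _).
exact: continuous_subspaceT.
Qed.

(** An eigenvalue constant on the whole segment would equal [entry v 1] by [constant_eigenvalue]. *)
Lemma band_measure (i : nat) : (i < width N)%N ->
  (forall t : R, (eigenvalues (Jacobi b v t))`_i != entry v 1) ->
  (0 < lebesgue_measure
     ((fun t => (eigenvalues (Jacobi b v t))`_i) @` `[0%R, (2 * pi)%R]))%E.
Proof.
move=> lti h; have pi0 := pi_ge0 R.
apply: image_segment_measure; [by rewrite mulr_ge0|exact: continuous_eigenvalue|].
apply: contrapT => H; have /eqP := h 0; apply.
apply: constant_eigenvalue => t t2.
have -> : (eigenvalues (Jacobi b v 0))`_i = (eigenvalues (Jacobi b v t))`_i.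
  apply/eqP/negPn/negP => ne; apply: H; exists 0, t.
  by split=> //; rewrite in_itv /= ?lexx ?mulr_ge0.
exact: eigenvalues_nth_vector.
Qed.

End Bands.

(** * The eigenvectors of [H b v] *)

Section Eigenvectors.
Variables (R : realType) (N : nat) (b : R) (v : 'I_(width N) -> R).
Local Notation C := R[i].
Implicit Types f : Gamma N -> C.

(** Chebyshev's argument: more than [m / r ^+ 2] points, each contributing at least [r ^+ 2], would
    exceed the total [m]. *)
Lemma square_summable_finite f (e : C) : square_summable f -> 0 < e ->
  finite_set [set x | e <= `|f x|].
Proof.
move=> sf e0; apply: contrapT => infS.
have /complex_realP[r er] : e \is Num.real by exact: gtr0_real.
have r0 : 0 < r by rewrite er -(rmorph0 (real_complex R)) ltcR in e0.
move: sf; rewrite /square_summable; set a := fun x => _; set M := esum _ _.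
have M0 : (0 <= M)%E by apply: esum_ge0 => x _; rewrite lee_fin sqr_ge0.
move=> Moo; have [m Mm] : exists m, M = m%:E.
  by exists (fine M); rewrite fineK// ge0_fin_numE.
have [B BS sB] := infinite_set_fset (Num.bound (m / r ^+ 2)) infS.
have r20 : 0 < r ^+ 2 by rewrite exprn_gt0.
have m0 : 0 <= m by rewrite -lee_fin -Mm.
have bm : m < (size (finmap.enum_fset B))%:R * r ^+ 2.
  rewrite -ltr_pdivrMr//.
  have /archi_boundP/lt_le_trans : 0 <= m / r ^+ 2 by rewrite divr_ge0// ltW.
  by apply; rewrite ler_nat.
have : (M < M)%E; last by rewrite ltxx.
rewrite {1}Mm.
apply: (@lt_le_trans _ _ ((size (finmap.enum_fset B))%:R * r ^+ 2)%:E).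
  by rewrite lte_fin.
apply: esum_ge; exists [set` B]; first by split.
rewrite -fsbig_seq ?finmap.fset_uniq// /a sumEFin lee_fin.
rewrite (_ : _%:R * _ = \sum_(x <- finmap.enum_fset B) r ^+ 2); last first.
  by rewrite big_const_seq count_predT iter_addr_0 mulr_natl.
rewrite [leLHS]big_seq [leRHS]big_seq. apply: ler_sum => x xB.
have : e <= `|f x| by exact: BS.
rewrite er normc_def lecR; case: (f x) => y z /= rx.
by rewrite ler_sqr ?nnegrE ?sqrtr_ge0// ltW.
Qed.

Definition cexp (n : int) : C := expi (b * n%:~R).

Lemma cexpD m n : cexp (m + n) = cexp m * cexp n.
Proof. by rewrite /cexp intrD mulrDr expiD. Qed.

Lemma cexpM m n x : cexp m * (cexp n * x) = cexp (m + n) * x.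
Proof. by rewrite cexpD mulrA. Qed.

Lemma expiN_cexp n : expi (- (b * n%:~R)) = cexp (- n).
Proof. by rewrite /cexp intrN mulrN. Qed.

(** Parity is that of the index counted from 0, so this is the row [2k+1] of [Delta]. The Dirichlet
    convention inside [at_site] covers both ends. *)
Lemma Delta_even f n k : (k <= N)%N ->
  Delta b f (n, inord k.*2) =
    cexp (- (2 * n + k%:Z)) * at_site f n k.*2
    + cexp (n + 2 * k%:Z) * at_site f (n - 1) k.*2.+2
    + cexp (n - k%:Z) * at_site f n k.*2.+2.
Proof.
move=> kN; rewrite /Delta /= inordK; last by rewrite /width; lia.
by rewrite /= odd_double /= uphalf_double mul2n addn2 expiN_cexp.
Qed.

Lemma Delta_odd f n k : (k < N)%N ->
  Delta b f (n, inord k.*2.+1) =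
    cexp (- (n - k%:Z)) * at_site f n k.*2.+1
    + cexp (- (n + 2 * k%:Z + 1)) * at_site f (n + 1) k.*2.+1
    + cexp (2 * n + k%:Z + 1) * at_site f n k.*2.+3.
Proof.
move=> kN; rewrite /Delta /= inordK; last by rewrite /width; lia.
rewrite /= odd_double /= doubleK !expiN_cexp.
rewrite (_ : (2 * k.+1 - 1)%N = k.*2.+1); last by lia.
rewrite (_ : (2 * k.+1 + 1)%N = k.*2.+3); last by lia.
by congr (cexp _ * _ + cexp _ * _ + cexp _ * _); lia.
Qed.

Lemma at_siteE f n (m : nat) : (m < width N)%N -> at_site f n m.+1 = f (n, inord m).
Proof. by move=> ltm; rewrite /at_site ltm. Qed.

(* The exponents are chosen to make the coefficients of [H b v] independent of
   [n].  Sites are numbered from 0 here, so even [m] are the odd sites of the paper. *)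
Definition gauge (m : nat) : int :=
  if odd m then (3 * m./2 + 3)%N%:Z else (3 * m./2 + 2)%N%:Z.

Definition gauged f (m : nat) : shift_seq C :=
  fun n => cexp (gauge m * n) * at_site f n m.+1.

Lemma gauged_even f k n :
  gauged f k.*2 n = cexp ((3 * k%:Z + 2) * n) * at_site f n k.*2.+1.
Proof. by rewrite /gauged /gauge odd_double doubleK; congr (cexp _ * _); lia. Qed.

Lemma gauged_odd f k n :
  gauged f k.*2.+1 n = cexp ((3 * k%:Z + 3) * n) * at_site f n k.*2.+2.
Proof.
rewrite /gauged /gauge /= odd_double uphalf_double.
by congr (cexp _ * _); lia.
Qed.

Lemma scale_polyC (x : C) (g : shift_seq C) n : (x%:P *: g) n = x * g n.
Proof. by rewrite scale_shift_seqE poly_actC. Qed.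

Lemma scale_polyX (x : C) (g : shift_seq C) n : ((x *: 'X) *: g) n = x * g (n + 1).
Proof.
by rewrite scale_shift_seqE poly_actZ -['X]mul1r poly_actMX poly_act1.
Qed.

Lemma decays_gauged f m : square_summable f -> decays (gauged f m).
Proof.
move=> sf e e0.
apply: sub_finite_set (finite_image fst (square_summable_finite sf e0)) => n /=.
rewrite /gauged normrM norm_expi mul1r; have [ltm|lem] := ltnP m (width N).
  by rewrite at_siteE// => H; exists (n, inord m).
by rewrite /at_site ifF ?normr0 ?lt_geF//; apply/negbTE; rewrite /= -leqNgt.
Qed.

Lemma eigenvalue_even f (lam : C) : square_summable f ->
  (exists x, f x != 0) -> (forall x, H b v f x = lam * f x) ->
  forall k, (k <= N)%N -> (entry v k.*2.+1)%:C = lam.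
Proof.
move=> sf f0 Hf.
pose c m : C := (entry v m.+1)%:C - lam.
(* The phase comes from the product of [lo] and [up]. It exceeds [coupling_phase k] by [2 * b], a
   translation of [t]; the argument uses only the degree of [W k]. *)
pose W k := band_quadratic (b * (6 * k + 3)%:R).
have sW k : size (W k) = 3%N by exact: size_band_quadratic.
suff Q0 : continuant (band_diag c) (band_prod W) (width N) = 0.
  by move=> k kN; have /eqP := continuant_eq0 sW Q0 kN; rewrite subr_eq0 => /eqP.
apply/eqP/negPn/negP => Q0.
pose up m : {poly C} :=
  if odd m then (cexp (m./2.+1)%:Z)%:P
  else cexp (- (m./2)%:Z) *: 'X + (cexp (5 * m./2 + 3)%N%:Z)%:P.
pose lo m : {poly C} :=
  if odd m then cexp (- (m./2.+1)%:Z) *: 'X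
  else (cexp (m./2)%:Z)%:P + cexp (- (5 * m./2 + 3)%N%:Z) *: 'X.
have w0 : (0 < width N)%N by [].
have Hrow n m : (m < width N)%N ->
    Delta b f (n, inord m) + c m * at_site f n m.+1 = 0.
  move=> ltm; have := Hf (n, inord m); rewrite /H /potential /=.
  rewrite -(at_siteE f)// => E; rewrite /c /entry /= mulrBl addrA E subrr //.
have up_even k : up k.*2 = cexp (- k%:Z) *: 'X + (cexp (5 * k%:Z + 3))%:P.
  rewrite /up odd_double doubleK; congr (_ + (cexp _)%:P); lia.
have up_odd k : up k.*2.+1 = (cexp (k%:Z + 1))%:P.
  rewrite /up /= odd_double uphalf_double; congr (cexp _)%:P; lia.
have lo_even k : lo k.*2 = (cexp k%:Z)%:P + cexp (- (5 * k%:Z + 3)) *: 'X.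
  rewrite /lo odd_double doubleK; congr (_ + cexp _ *: _); lia.
have lo_odd k : lo k.*2.+1 = cexp (- (k%:Z + 1)) *: 'X.
  rewrite /lo /= odd_double uphalf_double; congr (cexp _ *: _); lia.
(* [T] is the term of the lower neighbour, zero in the first row, so that one computation serves all
   even rows. They are read at [n + 1], which is the multiplication by ['X]. *)
have even_row k (T : shift_seq C) : (k <= N)%N ->
    (forall n, T n = cexp ((3 * k%:Z + 2) * (n + 1)) *
       (cexp (- (2 * (n + 1) + k%:Z)) * at_site f (n + 1) k.*2)) ->
    T + band_diag c k.*2 *: gauged f k.*2 + up k.*2 *: gauged f k.*2.+1 = 0.
  move=> kN TE; apply/funext => n; rewrite !shift_seqD up_even scalerDl shift_seqD.
  rewrite band_diag_even !scale_polyX scale_polyC TE.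
  have lt2 : (k.*2 < width N)%N by rewrite /width; lia.
  have := Hrow (n + 1) _ lt2; rewrite Delta_even// addrK.
  rewrite gauged_even !gauged_odd => E.
  rewrite -[RHS](mulr0 (cexp ((3 * k%:Z + 2) * (n + 1)))) -[in RHS]E.
  set s := cexp ((3 * k%:Z + 2) * (n + 1)).
  have -> : cexp (- k%:Z) *
        (cexp ((3 * k%:Z + 3) * (n + 1)) * at_site f (n + 1) k.*2.+2)
      = s * (cexp (n + 1 - k%:Z) * at_site f (n + 1) k.*2.+2).
    by rewrite !cexpM; congr (cexp _ * _); ring.
  have -> : cexp (5 * k%:Z + 3) * (cexp ((3 * k%:Z + 3) * n) * at_site f n k.*2.+2)
      = s * (cexp (n + 1 + 2 * k%:Z) * at_site f n k.*2.+2).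
    by rewrite !cexpM; congr (cexp _ * _); ring.
  by ring.
have r0 : band_diag c 0 *: gauged f 0 + up 0%N *: gauged f 1 = 0.
  by rewrite -[X in X + _]add0r; apply: (even_row 0%N) => // n; rewrite !mulr0.
have rS m : (m.+1 < width N)%N ->
    lo m *: gauged f m + band_diag c m.+1 *: gauged f m.+1
    + up m.+1 *: gauged f m.+2 = 0.
  rewrite -(odd_double_half m); move: m./2 => k.
  case: odd; rewrite ?add1n ?add0n => ltm.
    have kN : (k.+1 <= N)%N by rewrite /width in ltm; lia.
    rewrite -doubleS; apply: even_row => // n.
    rewrite lo_odd scale_polyX gauged_odd !cexpM doubleS.
    by congr (cexp _ * _); rewrite (_ : k.+1%:Z = k%:Z + 1); [ring | lia].
  have kN : (k < N)%N by rewrite /width in ltm; lia.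
  apply/funext => n; rewrite !shift_seqD lo_even scalerDl shift_seqD.
  rewrite up_odd band_diag_odd !scale_polyX !scale_polyC -doubleS.
  rewrite !gauged_even gauged_odd.
  have := Hrow n _ ltm; rewrite Delta_odd// doubleS => E.
  rewrite -[RHS](mulr0 (cexp ((3 * k%:Z + 3) * n))) -[in RHS]E.
  set s := cexp ((3 * k%:Z + 3) * n).
  have -> : cexp k%:Z * (cexp ((3 * k%:Z + 2) * n) * at_site f n k.*2.+1)
      = s * (cexp (- (n - k%:Z)) * at_site f n k.*2.+1).
    by rewrite !cexpM; congr (cexp _ * _); ring.
  have -> : cexp (- (5 * k%:Z + 3)) *
        (cexp ((3 * k%:Z + 2) * (n + 1)) * at_site f (n + 1) k.*2.+1)
      = s * (cexp (- (n + 2 * k%:Z + 1)) * at_site f (n + 1) k.*2.+1).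
    by rewrite !cexpM; congr (cexp _ * _); ring.
  have -> : cexp (k%:Z + 1) * (cexp ((3 * k.+1%:Z + 2) * n) * at_site f n k.*2.+3)
      = s * (cexp (2 * n + k%:Z + 1) * at_site f n k.*2.+3).
    rewrite !cexpM; congr (cexp _ * _).
    by rewrite (_ : k.+1%:Z = k%:Z + 1); [ring | lia].
  by ring.
have S := continuant_solve w0 r0 rS.
have wE : (fun i => lo i * up i) = band_prod W.
  have cexpN n : cexp (- n) * cexp n = 1 by rewrite -cexpD addNr /cexp mulr0 expi0.
  apply/funext => m; rewrite -(odd_double_half m); move: m./2 => k.
  case: odd; rewrite ?add1n ?add0n.
    rewrite lo_odd up_odd band_prod_odd -scalerAl mulrC mul_polyC scalerA.
    by rewrite cexpN scale1r.
  rewrite lo_even up_even band_prod_even /W /band_quadratic.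
  have -> : b * (6 * k + 3)%:R = b * (6 * k%:Z + 3)%:~R.
    by congr (b * _); rewrite -[LHS]/((6 * k + 3)%N%:Z%:~R); congr (_%:~R); lia.
  rewrite expiN_cexp -/(cexp _).
  have -> : cexp (6 * k%:Z + 3) = cexp k%:Z * cexp (5 * k%:Z + 3).
    by rewrite -cexpD; congr cexp; ring.
  have -> : cexp (- (6 * k%:Z + 3)) = cexp (- k%:Z) * cexp (- (5 * k%:Z + 3)).
    by rewrite -cexpD; congr cexp; ring.
  have := cexpN k%:Z; have := cexpN (5 * k%:Z + 3).
  move: (cexp (- k%:Z)) (cexp k%:Z) => x' x.
  move: (cexp (- _)) (cexp (5 * _ + _)) => y' y yy xx.
  rewrite -!mul_polyC !polyCM.
  have xx' : x'%:P * x%:P = 1 :> {poly C} by rewrite -polyCM xx.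
  have yy' : y'%:P * y%:P = 1 :> {poly C} by rewrite -polyCM yy.
  (* The middle coefficient 2 is the sum of two products of inverse phases. *)
  rewrite (_ : 2%:P * 'X = (x'%:P * x%:P + y'%:P * y%:P) * 'X); first by ring.
  by rewrite xx' yy' (_ : 2 = 1 + 1 :> C) ?polyCD.
rewrite wE in S.
have up0 m : up m != 0.
  have : band_prod W m != 0.
    by rewrite /band_prod; case: odd; rewrite ?polyX_eq0 -?size_poly_gt0 ?sW.
  by rewrite -wE; apply: contraNneq => ->; rewrite mulr0.
have gp : gauged f (width N) = 0.
  by apply/funext => n; rewrite /gauged /at_site ltnn andbF mulr0.
have g0 : gauged f 0 = 0.
  apply: decays_torsion_free (decays_gauged 0 sf) Q0 _.
  by rewrite -(S _ (leqnn _)) gp scaler0.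
(* Every [up i] is a nonzero polynomial, so torsion-freeness also cancels their products and the
   whole of [f] vanishes. *)
have gm m : (m < width N)%N -> gauged f m = 0.
  move=> ltm; apply: decays_torsion_free (decays_gauged m sf) _ _.
    have pu : \prod_(i < m) up i != 0 by apply/prodf_neq0.
    exact: pu.
  by rewrite (S _ (ltnW ltm)) g0 scaler0.
case: f0 => -[n j] /eqP; apply.
have := congr1 (fun g : shift_seq C => g n) (gm j (ltn_ord j)).
rewrite /gauged at_siteE// inord_val => /eqP.
by rewrite mulf_eq0 (negbTE (expi_neq0 _)) => /eqP.
Qed.

End Eigenvectors.

(** * A finitely supported eigenvector for a flat potential *)

Section CompactEigenvector.
Variables (R : realType) (N : nat) (b : R) (v : 'I_(width N) -> R).
Local Notation C := R[i].

Lemma square_summable_support (f : Gamma N -> C) (S : set (Gamma N)) :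
  finite_set S -> (forall x, f x != 0 -> S x) -> square_summable f.
Proof.
move=> finS fS; rewrite /square_summable.
rewrite (_ : esum _ _ =
    \esum_(x in S) (ComplexField.Normc.normc (f x) ^+ 2)%:E).
  rewrite esum_fset// => [|x _]; last by rewrite lee_fin sqr_ge0.
  by rewrite fsbig_finite// sumEFin ltry.
rewrite [RHS]esum_mkcond; apply: eq_esum => x _; case: ifPn => // xS.
rewrite (_ : f x = 0); first by rewrite ComplexField.Normc.normc0 expr0n.
by apply/eqP/negPn/negP => /fS; rewrite -in_setE (negbTE xS).
Qed.

(** Starting from a unit mass at [n = 0], the equation of row [k.*2.+1] with zero right-hand side is
    solved for its upper neighbour. Each step uses the values at [n] and [n + 1], so the support
    grows by one site to the left. *)
Fixpoint flat_amplitude (k : nat) (n : int) : C :=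
  if k is k'.+1 then
    - (cexp b (- (2 * n + k'%:Z + 1)) *
       (cexp b (- (n - k'%:Z)) * flat_amplitude k' n
        + cexp b (- (n + 2 * k'%:Z + 1)) * flat_amplitude k' (n + 1)))
  else (n == 0)%:R.

Lemma flat_amplitude_support k n :
  flat_amplitude k n != 0 -> (- k%:Z <= n) && (n <= 0).
Proof.
elim: k n => [|k IH] n /=; first by case: (eqVneq n 0) => [->//|_]; rewrite eqxx.
rewrite oppr_eq0 mulf_eq0 negb_or => /andP[_] nz.
have : (flat_amplitude k n != 0) || (flat_amplitude k (n + 1) != 0).
  apply: contraNT nz; rewrite negb_or !negbK => /andP[/eqP-> /eqP->].
  by rewrite !mulr0 addr0.
by case/orP => /IH; lia.
Qed.

Definition flat_vector : Gamma N -> C :=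
  fun x => if odd x.2 then 0 else flat_amplitude x.2./2 x.1.

Lemma flat_vector_summable : square_summable flat_vector.
Proof.
pose F (p : 'I_N.+1 * 'I_(width N)) : Gamma N := (- (p.1 : nat)%:Z, p.2).
apply: (@square_summable_support _ (F @` setT)).
  by apply: finite_image; exact: finite_finset.
move=> [n j]; rewrite /flat_vector /=; case: ifP => [_|oj]; first by rewrite eqxx.
move=> /flat_amplitude_support nj.
have jN : (j./2 <= N)%N by have := ltn_ord j; rewrite /width; lia.
have ltn : (`|n| < N.+1)%N by move: (j./2) jN nj => k; lia.
exists (Ordinal ltn, j) => //; rewrite /F /=; congr (_, _).
by case/andP: nj => _ n0; rewrite abszE ler0_norm// opprK.
Qed.

Lemma at_site_flat_odd n k : at_site flat_vector n k.*2 = 0.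
Proof.
rewrite /at_site; case: ifP => // kN; rewrite /entry /flat_vector /=.
rewrite /width in kN; rewrite inordK; last by lia.
by rewrite ifT//; lia.
Qed.

Lemma at_site_flat_even n k : (k <= N)%N ->
  at_site flat_vector n k.*2.+1 = flat_amplitude k n.
Proof.
move=> kN; rewrite at_siteE; last by rewrite /width; lia.
rewrite /flat_vector /= inordK; last by rewrite /width; lia.
by rewrite odd_double doubleK.
Qed.

(** Rows of odd index cancel by the recursion of [flat_amplitude]; rows of even index see only
    neighbours where the vector is zero, leaving the potential [c]. *)
Lemma flat_vector_eigen (c : R) : (forall k, (k <= N)%N -> entry v k.*2.+1 = c) ->
  forall x, H b v flat_vector x = c%:C * flat_vector x.
Proof.
move=> vc [n j]; rewrite /H /potential /=.
have jN := ltn_ord j; rewrite -[j]inord_val -(odd_double_half j).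
have : (odd j + j./2.*2 < width N)%N by rewrite odd_double_half.
move: j./2 {jN} => k; case: odd => ltk; rewrite ?add1n ?add0n in ltk *.
  have kN : (k < N)%N by rewrite /width in ltk; lia.
  rewrite Delta_odd// !at_site_flat_even ?(ltnW kN)// -doubleS at_site_flat_even//=.
  rewrite (_ : flat_vector (n, inord k.*2.+1) = 0); last first.
    by rewrite /flat_vector /= inordK//= odd_double.
  rewrite !mulr0 addr0.
  rewrite mulrN mulrA -cexpD subrr.
  by rewrite [cexp b 0]/cexp mulr0 expi0 mul1r subrr.
have kN : (k <= N)%N by rewrite /width in ltk; lia.
rewrite Delta_even// -doubleS !at_site_flat_odd !mulr0 !add0r.
by have := vc k kN; rewrite /entry /= => ->.
Qed.

Lemma flat_vector_neq0 : exists x, flat_vector x != 0.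
Proof. by exists (0, ord0); rewrite /flat_vector /= oner_eq0. Qed.

End CompactEigenvector.

Theorem theorem1p3 (R : realType) (N : nat) (hN : (1 <= N)%N)
    (b : R) (v : 'I_(width N) -> R) :
  (sigma_pp b v !=set0 <->
     forall n : nat, (1 <= n <= N)%N -> entry v (2 * n + 1) = entry v 1)
  /\
  (sigma_pp b v !=set0 ->
     [/\ sigma_pp b v = real_complex R @` sigma b v 0,
         sigma b v 0 = [set entry v 1] &
         forall n : nat, (1 <= n <= N)%N ->
           [/\ (0 < lebesgue_measure (sigma b v n%:Z))%E,
               sigma b v n%:Z `<=` `]entry v 1, +oo[ &
               sigma b v (- n%:Z) `<=` `]-oo, entry v 1[ ]]).
Proof.
(* Any eigenvalue equals every entry [entry v k.*2.+1]: this yields both the flatness of the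
   potential and the uniqueness of the eigenvalue. *)
have pp_even lam : sigma_pp b v lam ->
    forall k, (k <= N)%N -> (entry v k.*2.+1)%:C = lam.
  by move=> [f [sf f0 Hf]]; exact: eigenvalue_even sf f0 Hf.
have flat : sigma_pp b v !=set0 ->
    forall k, (k <= N)%N -> entry v k.*2.+1 = entry v 1.
  move=> [lam /pp_even h] k kN; apply: complexI; rewrite (h k kN).
  by rewrite -(h 0%N (leq0n N)).
have pp_flat : (forall k, (k <= N)%N -> entry v k.*2.+1 = entry v 1) ->
    sigma_pp b v (entry v 1)%:C.
  move=> vc; exists (@flat_vector R N b); split.
  - exact: flat_vector_summable.
  - exact: flat_vector_neq0.
  - exact: flat_vector_eigen.
split.
  split=> [/flat h n /andP[_ nN]|h]; first by rewrite mul2n addn1 h.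
  exists (entry v 1)%:C; apply: pp_flat => -[|k] kN //.
  by rewrite -[in LHS]addn1 -mul2n h.
move=> /flat vc.
have vj (j : 'I_(width N)) : ~~ odd j -> v j = entry v 1.
  move=> ej; rewrite -(vc j./2); last by have := ltn_ord j; rewrite /width; lia.
  rewrite /entry /= (_ : j./2.*2 = j) ?inord_val//.
  by rewrite -[RHS]odd_double_half (negbTE ej).
have pi0 : 0 <= 2 * pi :> R by rewrite mulr_ge0// pi_ge0.
(* Bands are numbered from [- N], the sorted eigenvalues from 0. *)
have lamE (k : int) (i : nat) : absz (N%:Z + k) = i ->
    sigma b v k = (fun t => (eigenvalues (Jacobi b v t))`_i) @` `[0%R, (2 * pi)%R].
  by move=> <-.
have s0 : sigma b v 0 = [set entry v 1].
  rewrite (lamE 0 N); last by rewrite addr0.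
  apply/seteqP; split=> [_ [t _ <-]|_ ->] /=; first exact: middle_eigenvalue.
  by exists 0; [rewrite /= in_itv /= lexx|exact: middle_eigenvalue].
split=> //.
  rewrite s0 image_set1; apply/seteqP; split=> [lam /pp_even h|_ ->] /=.
    by rewrite -(h 0%N (leq0n N)).
  exact: pp_flat.
move=> n /andP[n0 nN].
have n0N : (0 < n <= N)%N by rewrite n0.
have lt : (N + n < width N)%N by rewrite /width; lia.
have up t : entry v 1 < (eigenvalues (Jacobi b v t))`_(N + n).
  exact: upper_eigenvalue.
rewrite (lamE n%:Z (N + n)%N)// (lamE (- n%:Z) (N - n)%N); last by lia.
split.
- by apply: band_measure => // t; rewrite gt_eqF.
- by move=> _ [t _ <-] /=; rewrite in_itv /= andbT.
- by move=> _ [t _ <-] /=; rewrite in_itv /=; exact: lower_eigenvalue.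
Qed.
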